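(* Let $r,t,k$ be integers with $k>r\geqslant 3$ and $1\leqslant t\leqslant k-r$. There exist positive constants $c=c(r,t)$ and $d=d(r,t)$ such that for every $n\geqslant ck^d$ and every $r$-wise $t$-intersecting family $\mathcal{F}\subseteq\binom{[n]}{k}$ we have $N_{r+1,t}(\mathcal{F})\leqslant N_{r+1,t}(\mathcal{G}_{r,t})$, and equality holds if and only if, up to isomorphism, $\mathcal{G}_{r,t}\subseteq\mathcal{F}\subseteq\mathcal{G}'_{r,t}$.
   Context: $[n]=\{1,\dots,n\}$ and $\binom{[n]}{k}$ is the family of all $k$-element subsets of $[n]$. A family $\mathcal{F}$ is $r$-wise $t$-intersecting if $|F_1\cap\cdots\cap F_r|\geqslant t$ for all $F_1,\dots,F_r\in\mathcal{F}$. A $(r+1,t)$-triangle is a family $\{T_1,\dots,T_{r+1}\}$ of $r+1$ sets which is $r$-wise $t$-intersecting and satisfies $|T_1\cap\cdots\cap T_{r+1}|\leqslant t-1$. For a family $\mathcal{F}$, $N_{r+1,t}(\mathcal{F})$ denotes the number of $(r+1)$-element subfamilies of $\mathcal{F}$ that are $(r+1,t)$-triangles. Define $\mathcal{G}_{r,t}=\{F\in\binom{[n]}{k}: |F\cap[r+t]|=r+t-1\}$ and $\mathcal{G}'_{r,t}=\{F\in\binom{[n]}{k}: |F\cap[r+t]|\geqslant r+t-1\}$. Two families are isomorphic if one is obtained from the other by a permutation of $[n]$. *)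

(* Defs.v *)
From mathcomp Require Import all_boot all_order all_fingroup.

Set Implicit Arguments.
Unset Strict Implicit.
Unset Printing Implicit Defensive.

(* The ground set [n] = {1, ..., n} is represented by 'I_n = {0, ..., n-1}, so
   that the initial segment [m] consists of the i : 'I_n with i < m. *)

Definition ksubsets (n k : nat) : {set {set 'I_n}} := 
  [set A : {set 'I_n} | #|A| == k].

Definition initseg (n m : nat) : {set 'I_n} := [set i : 'I_n | i < m].

(* The sets A 0, ..., A (r-1) are not required to be distinct. *)
Definition rwise_intersecting (n r t : nat) (F : {set {set 'I_n}}) : bool :=
  [forall A : {ffun 'I_r -> {set 'I_n}},
     [forall i, A i \in F] ==> (t <= #|\bigcap_(i < r) A i|)].

(* The parameter r here gives an (r+1,t)-triangle. *)
Definition triangle (n r t : nat) (T : {set {set 'I_n}}) : bool :=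
  [&& #|T| == r.+1, rwise_intersecting r t T & #|\bigcap_(A in T) A| < t].

Definition num_triangles (n r t : nat) (F : {set {set 'I_n}}) : nat :=
  #|[set T : {set {set 'I_n}} | (T \subset F) && triangle r t T]|.

Definition Gfam (n k r t : nat) : {set {set 'I_n}} :=
  [set A in ksubsets n k | #|A :&: initseg n (r + t)| == r + t - 1].

Definition Gfam' (n k r t : nat) : {set {set 'I_n}} :=
  [set A in ksubsets n k | r + t - 1 <= #|A :&: initseg n (r + t)|].

Definition isomorphic (n : nat) (F F' : {set {set 'I_n}}) : Prop :=
  exists s : {perm 'I_n}, F' = [set s @: A | A : {set 'I_n} in F].

(* Main.v *)
Require Import Defs.
From mathcomp Require Import all_boot all_order all_fingroup.
From mathcomp Require Import zify.

(** Let [a = r + t - 1].  If the intersection of all of [F] has fewer than [t]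
    points, then any [i <= r] members of [F] share at least [r + t - i] points.
    With [i = 2] a branching argument shows that [F] has at most
    [k ^ a * 'C(n - a, k - a)] members.  Call an [a]-set [S] heavy if, for every
    set [Z] of at most [k] points, some member of [F] contains [S] and avoids
    [Z] outside [S].  Members of [F] containing no heavy set are rarer by a
    factor of order [n], so triangles using one of them are negligible.  Adding
    the heavy sets to [F] preserves the intersection property, so heavy sets
    pairwise share [a - 1] points: either they have [t] points in common, and
    every triangle uses one of the rare sets, or they all lie in a set [Y] of
    [r + t] points.  If some [Y :\ y] is not heavy, then [F] misses all
    triangles of the extremal family on [Y] that use a set [A] with
    [A :&: Y = Y :\ y], and these outnumber the negligible ones.  If every
    [Y :\ y] is heavy, then every member of [F] misses at most one point of [Y],
    and [F] lies between the two extremal families or has fewer triangles. *)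

Set Implicit Arguments.
Unset Strict Implicit.
Unset Printing Implicit Defensive.

(** * Unions, intersections and families with the meeting property *)

Lemma card_bigcup_le (T I : finType) (P : {set I}) (E : I -> {set T}) :
  #|\bigcup_(i in P) E i| <= \sum_(i in P) #|E i|.
Proof.
elim/big_rec2: _ => [|i m B _ IH]; first by rewrite cards0.
by apply: leq_trans (leq_card_setU _ _) _; rewrite leq_add2l.
Qed.

Section SetLemmas.
Context {T : finType}.
Implicit Types (A B S Y Z : {set T}) (F R : {set {set T}}).

Lemma bigcap_setU1 A R :
  \bigcap_(B in A |: R) B = A :&: \bigcap_(B in R) B.
Proof.
apply/setP=> x; rewrite inE; apply/bigcapP/andP.
- move=> H; split; first by apply: H; rewrite setU11.
  by apply/bigcapP=> B BR; apply: H; rewrite setU1r.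
- by case=> xA /bigcapP H B /setU1P[->|/H].
Qed.

Lemma sub_bigcap R F : R \subset F ->
  \bigcap_(A in F) A \subset \bigcap_(A in R) A.
Proof.
move=> /subsetP RF; apply/bigcapsP=> A /RF AF; exact: bigcap_inf.
Qed.

(** Removing [D] is a bijection onto the subsets of [E :\: D] with [k - #|D|] points. *)
Lemma card_between (D E : {set T}) k : D \subset E -> #|D| <= k ->
  #|[set A : {set T} | [&& #|A| == k, D \subset A & A \subset E]]|
  = 'C(#|E| - #|D|, k - #|D|).
Proof.
move=> DE Dk; rewrite -(cardsDS DE) -cards_draws.
rewrite -(@card_in_imset _ _ (fun A => A :\: D)).
  congr #|pred_of_set _|; apply/setP=> B; rewrite inE; apply/imsetP/andP.
  - case=> A; rewrite inE => /and3P[/eqP cA DA AE] ->.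
    by rewrite setSD // cardsDS // cA.
  - case; rewrite subsetD => /andP[BE dBD] /eqP cB; exists (B :|: D).
      rewrite inE subsetUr subUset BE DE !andbT cardsU.
      by move: dBD; rewrite -setI_eq0 => /eqP->; rewrite cards0; lia.
    by rewrite setDUl setDv setU0; apply/esym/setDidPl.
move=> A B; rewrite !inE => /and3P[_ DA _] /and3P[_ DB _] eqD.
by rewrite -(setID A D) -(setID B D) eqD (setIidPr DA) (setIidPr DB).
Qed.

Definition family_above F S := [set A in F | S \subset A].

(** The range of an [r]-tuple with repetitions is a nonempty set of at most [r] members, and
    inductions on [R] are easier in this form. An empty [R] is excluded because its intersection is
    the whole type. *)
Definition meeting r t F := forall R,
  R \subset F -> R != set0 -> #|R| <= r -> t <= #|\bigcap_(A in R) A|.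


Lemma not_sub_bigcap Z F : ~~ (Z \subset \bigcap_(A in F) A) ->
  exists2 A, A \in F & ~~ (Z \subset A).
Proof.
move=> H; apply/exists_inP; apply: contraR H => /exists_inPn H.
by apply/bigcapsP=> A /H; rewrite negbK.
Qed.

(* Extending [R] by a member of [F] that does not contain its intersection
   costs at least one point, and this can be repeated until [#|R| = r]. *)
Lemma meeting_nontrivial r t F R : meeting r t F ->
  #|\bigcap_(A in F) A| < t ->
  R \subset F -> R != set0 -> #|R| <= r -> r + t <= #|\bigcap_(A in R) A| + #|R|.
Proof.
move=> hF ntF; elim: {R}(r - #|R|) {-2}R (leqnn (r - #|R|)) => [|j IH] R hj RF R0 Rr.
  by have := hF _ RF R0 Rr; lia.
have [|ltR] := leqP r #|R|; first by have := hF _ RF R0 Rr; lia.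
have : ~~ (\bigcap_(A in R) A \subset \bigcap_(A in F) A).
  by apply/negP=> /subset_leq_card; have := hF _ RF R0 Rr; lia.
case/not_sub_bigcap=> A AF nsub.
have AR : A \notin R by apply: contra nsub => AR; apply: bigcap_inf.
have cR : #|A |: R| = #|R|.+1 by rewrite cardsU1 AR.
have : #|A :&: \bigcap_(B in R) B| < #|\bigcap_(B in R) B|.
  apply: proper_card; rewrite properE subsetIr /=.
  by apply: contra nsub; rewrite subsetI => /andP[].
have := IH (A |: R); rewrite bigcap_setU1 cR subUset sub1set AF RF /=.
have -> : A |: R != set0 by rewrite -card_gt0 cR.
have hj' : r - #|R|.+1 <= j by lia.
by move=> /(_ hj' isT isT ltR); lia.
Qed.

Lemma meeting_pair r t F A B : 1 < r -> meeting r t F ->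
  #|\bigcap_(A in F) A| < t -> A \in F -> B \in F -> r + t <= #|A :&: B| + 2.
Proof.
move=> r1 hF ntF AF BF.
have c2 : #|[set A; B]| <= 2 by rewrite cards2; case: (_ != _).
have := meeting_nontrivial (R := [set A; B]) hF ntF.
rewrite bigcap_setU1 big_set1 subUset !sub1set AF BF /=.
have -> : [set A; B] != set0 by apply/set0Pn; exists A; rewrite set21.
by move=> /(_ isT isT (leq_trans c2 r1))/leq_trans; apply; rewrite leq_add2l.
Qed.

(** One branching step: every member above [S] passes through one of the at most [k] points of [Z]
    outside [S], and a union bound over these points applies. *)
Lemma card_family_above_le F S Z k X :
  (forall A, A \in F -> S \subset A -> exists2 x, x \in A & x \in Z :\: S) ->
  (forall x, x \notin S -> #|family_above F (x |: S)| <= X) ->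
  #|Z| <= k -> #|family_above F S| <= k * X.
Proof.
move=> hZ hX Zk.
have sub : family_above F S \subset \bigcup_(x in Z :\: S) family_above F (x |: S).
  apply/subsetP=> A; rewrite inE => /andP[AF SA].
  have [x xA xZ] := hZ A AF SA; apply/bigcupP; exists x => //.
  by rewrite inE AF subUset sub1set xA.
apply: leq_trans (subset_leq_card sub) _; apply: leq_trans (card_bigcup_le _ _) _.
have : \sum_(x in Z :\: S) #|family_above F (x |: S)| <= \sum_(x in Z :\: S) X.
  by apply: leq_sum => x; rewrite inE => /andP[/hX].
move/leq_trans; apply; rewrite sum_nat_const leq_mul2r.
by rewrite (leq_trans (subset_leq_card (subsetDl _ _)) Zk) orbT.
Qed.

(* Any two members of [F] share [r + t - 2] points, so a set [S] of fewer than
   [r + t - 1] points can be enlarged in at most [k] ways, by the points of a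
   member of [F] that has fewer than [r + t - 2] points in common with [S]. *)
Lemma card_subfamily_le r t k F F' X : 1 < r -> meeting r t F ->
  #|\bigcap_(A in F) A| < t -> {in F, forall A, #|A| = k} -> F' \subset F ->
  (forall S, #|S| = r + t - 1 -> #|family_above F' S| <= X) ->
  #|F'| <= k ^ (r + t - 1) * X.
Proof.
move=> r1 hF ntF hk sF hX.
suff H j S : #|S| + j = r + t - 1 -> #|family_above F' S| <= k ^ j * X.
  have -> : F' = family_above F' set0.
    by apply/setP=> A; rewrite inE sub0set andbT.
  by apply: H; rewrite cards0.
elim: j S => [|j IH] S cS; first by rewrite mul1n; apply: hX; lia.
case: (set_0Vmem (family_above F' S)) => [->|[A0]]; first by rewrite cards0.
rewrite inE => /andP[A0F _]; move: (subsetP sF _ A0F) => {}A0F.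
have [B BF hB] : exists2 B, B \in F & #|S :&: B| + 2 < r + t.
  have [ltS|geS] := ltnP (#|S| + 2) (r + t).
    by exists A0 => //; have := subset_leq_card (subsetIl S A0); lia.
  (* Here [S] has exactly [r + t - 2 >= t] points, too many to lie in all members of [F]. *)
  have : ~~ (S \subset \bigcap_(A in F) A).
    by apply/negP=> /subset_leq_card; lia.
  case/not_sub_bigcap=> B BF nSB; exists B => //.
  suff : #|S :&: B| < #|S| by lia.
  apply: proper_card; rewrite properE subsetIl /=.
  by apply: contra nSB; rewrite subsetI => /andP[].
rewrite expnS -mulnA; apply: (@card_family_above_le _ _ B).
- move=> A AF SA; have := meeting_pair r1 hF ntF (subsetP sF _ AF) BF => hAB.
  have : ~~ (A :&: B \subset S :&: B) by apply/negP=> /subset_leq_card; lia.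
  case/subsetPn=> x; rewrite !inE => /andP[xA xB]; rewrite xB andbT => xS.
  by exists x => //; rewrite !inE xS.
- by move=> x xS; apply: IH; rewrite cardsU1 xS; lia.
- by rewrite hk.
Qed.

(** * Heavy sets and light members *)

(** A heavy set is the core of a flower in [F]: no [k] points meet all the petals [A :\: S]. *)
Definition heavy a k F := [set S : {set T} | (#|S| == a) &&
  [forall Z : {set T}, (#|Z| <= k) ==>
     [exists A in F, (S \subset A) && [disjoint A :\: S & Z]]]].

Definition light a k F :=
  [set A in F | [forall S in heavy a k F, ~~ (S \subset A)]].

(* A member [S] of [heavy a k F] can be replaced by some [A] in [F] that meets
   the intersection of the remaining sets in the same points as [S]. *)
Lemma meeting_heavy r t a k F : t <= a -> a <= k -> {in F, forall A, #|A| = k} ->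
  meeting r t F -> meeting r t (F :|: heavy a k F).
Proof.
move=> ta ak hk hF R.
elim: {R}#|R :\: F| {-2}R (leqnn #|R :\: F|) => [|i IH] R hi RFH R0 Rr.
  by apply: hF => //; rewrite -setD_eq0 -cards_eq0 -leqn0.
have [RF|/subsetPn[S SR SF]] := boolP (R \subset F); first exact: hF.
have := subsetP RFH S SR; rewrite inE (negPf SF) inE => /andP[/eqP cS /forallP hS].
have eR : S |: (R :\ S) = R by rewrite setD1K.
have cR : #|R| = #|R :\ S|.+1 by rewrite (cardsD1 S R) SR.
have cRF : #|R :\: F| = #|(R :\: F) :\ S|.+1.
  by rewrite (cardsD1 S (R :\: F)) inE SF SR.
have [RS0|[B BRS]] := set_0Vmem (R :\ S).
  by rewrite -eR RS0 setU0 big_set1 cS.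
rewrite -eR bigcap_setU1; set Z := \bigcap_(_ in _) _.
have Zk : #|Z| <= k.
  apply: leq_trans (subset_leq_card (bigcap_inf B BRS)) _.
  move: BRS; rewrite inE => /andP[_ /(subsetP RFH)]; rewrite inE.
  by case/orP=> [/hk->//|]; rewrite inE => /andP[/eqP->].
have := implyP (hS Z) Zk; case/exists_inP=> A AF /andP[SA dA].
have sub : A :&: Z \subset S :&: Z.
  apply/subsetP=> x; rewrite !inE => /andP[xA xZ]; rewrite xZ andbT.
  have := disjointFl dA xZ; rewrite inE xA andbT.
  by move/negbT; rewrite negbK.
apply: leq_trans (subset_leq_card sub); rewrite -bigcap_setU1.
have RS : R :\ S \subset R by rewrite subsetDl.
apply: IH.
- apply: (@leq_trans #|(R :\: F) :\ S|); last by rewrite -ltnS -cRF.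
  apply: subset_leq_card; apply/subsetP=> C; rewrite !inE.
  case/andP=> CF; rewrite CF; case/orP=> [/eqP CA|/andP[-> ->]//].
  by rewrite CA AF in CF.
- by rewrite subUset sub1set inE AF (subset_trans RS).
- by apply/set0Pn; exists A; rewrite setU11.
- by apply: leq_trans Rr; rewrite cR cardsU1; case: (_ \notin _) => //=; rewrite add0n.
Qed.

(** A set [Z] refuting heaviness meets every member above [S] outside [S], so it serves as the set
    of branching points. *)
Lemma card_family_above_not_heavy a k F S L : #|S| = a -> S \notin heavy a k F ->
  (forall x, x \notin S -> #|family_above F (x |: S)| <= L) ->
  #|family_above F S| <= k * L.
Proof.
move=> cS; rewrite inE cS eqxx /= => /forallPn[Z]; rewrite negb_imply => /andP[Zk].
move/exists_inPn=> hZ hL; apply: (@card_family_above_le F S Z) => // A AF SA.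
have := hZ A AF; rewrite SA /= -setI_eq0 => /set0Pn[x].
rewrite !inE => /andP[/andP[xS xA] xZ].
by exists x => //; rewrite !inE xS.
Qed.

(** No light member lies above a heavy set. Above any other set of [r + t - 1] points one more
    branching step is possible, at the cost of a factor [k], and reaches sets of [r + t] points. *)
Lemma card_light r t k F L : 1 < r -> meeting r t F ->
  #|\bigcap_(A in F) A| < t -> {in F, forall A, #|A| = k} ->
  (forall S, #|S| = r + t -> #|family_above F S| <= L) ->
  #|light (r + t - 1) k F| <= k ^ (r + t - 1) * (k * L).
Proof.
move=> r1 hF ntF hk hL; apply: (card_subfamily_le r1 hF ntF hk).
  by apply/subsetP=> A; rewrite inE => /andP[].
move=> S cS; have [hS|nS] := boolP (S \in heavy (r + t - 1) k F).
  suff -> : family_above (light (r + t - 1) k F) S = set0 by rewrite cards0.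
  apply/setP=> A; rewrite inE [RHS]inE; apply/negP=> /andP[].
  by rewrite inE => /andP[_ /forall_inP/(_ _ hS)/negP].
apply: (@leq_trans #|family_above F S|).
  apply/subset_leq_card/subsetP=> A; rewrite !inE => /andP[/andP[-> _] ->] //.
apply: (card_family_above_not_heavy cS nS) => x xS; apply: hL.
by rewrite cardsU1 xS; lia.
Qed.

(** Two distinct members [S1], [S2] span [a + 1] points. A member [S3] outside their union would
    force all members to contain [S1 :&: S2], which has [a - 1] points. *)
Lemma almost_equal_sets a (H : {set {set T}}) : a <= #|T| ->
  {in H, forall S, #|S| = a} ->
  (forall S1 S2 : {set T}, S1 \in H -> S2 \in H -> a <= #|S1 :&: S2| + 1) ->
  #|\bigcap_(S in H) S| + 1 < a ->
  exists2 Y : {set T}, #|Y| = a + 1 & {in H, forall S, S \subset Y}.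
Proof.
move=> aT ca pa ntH.
(* The intersection of an empty [H] is the whole type, which has at least [a] points. *)
have [H0|[S1 H1]] := set_0Vmem H.
  by move: ntH; rewrite H0 big_set0 cardsT; lia.
have : ~~ (S1 \subset \bigcap_(S in H) S).
  by apply/negP=> /subset_leq_card; rewrite ca //; lia.
case/not_sub_bigcap=> S2 H2 S12.
have cK : #|S1 :&: S2| + 1 = a.
  have : #|S1 :&: S2| < #|S1|.
    apply: proper_card; rewrite properE subsetIl /=.
    by apply: contra S12; rewrite subsetI => /andP[].
  by have := pa _ _ H1 H2; rewrite (ca _ H1); lia.
have cY : #|S1 :|: S2| = a + 1 by rewrite cardsU (ca _ H1) (ca _ H2); lia.
have [/forall_inP ?|/forall_inPn[S3 H3 S3Y]] :=
  boolP [forall S in H, S \subset S1 :|: S2]; first by exists (S1 :|: S2).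
(* Such an [S] has at most [a - 1] points in the union, and already shares that many with each of
   [S1] and [S2]. *)
have out S : S \in H -> ~~ (S \subset S1 :|: S2) ->
    S :&: (S1 :|: S2) = S1 :&: S2.
  move=> HS nS.
  have lt : #|S :&: (S1 :|: S2)| < a.
    rewrite -(ca _ HS); apply: proper_card; rewrite properE subsetIl /=.
    by apply: contra nS; rewrite subsetI => /andP[].
  have e1 : S :&: S1 = S :&: (S1 :|: S2).
    apply/eqP; rewrite eqEcard setIS ?subsetUl //=.
    by have := pa _ _ HS H1; lia.
  have e2 : S :&: S2 = S :&: (S1 :|: S2).
    apply/eqP; rewrite eqEcard setIS ?subsetUr //=.
    by have := pa _ _ HS H2; lia.
  apply/eqP; rewrite eqEcard; apply/andP; split.
    by rewrite subsetI -{1}e1 -e2 !subsetIr.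
  by rewrite -e1; have := pa _ _ HS H1; lia.
suff : S1 :&: S2 \subset \bigcap_(S in H) S by move/subset_leq_card; lia.
apply/bigcapsP=> S HS; have [SY|/(out _ HS) <-] := boolP (S \subset S1 :|: S2).
  (* A member inside the union meets [S3] only within [S1 :&: S2], and must share [a - 1] points
     with it. *)
  suff <- : S :&: S3 = S1 :&: S2 by rewrite subsetIl.
  apply/eqP; rewrite eqEcard -{1}(out _ H3 S3Y) setIC setIS //=.
  by have := pa _ _ HS H3; rewrite setIC; lia.
by rewrite subsetIl.
Qed.

End SetLemmas.

(** * Extremal families on an arbitrary set [Y], and their slices *)

Section Slices.
Context {T : finType}.
Implicit Types (A B S Y Z : {set T}) (F R : {set {set T}}).

Definition Gset k r t Y := [set A : {set T} | (#|A| == k) && (#|A :&: Y| == r + t - 1)].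
Definition Gset' k r t Y := [set A : {set T} | (#|A| == k) && (r + t - 1 <= #|A :&: Y|)].

Lemma Gset_sub k r t Y : Gset k r t Y \subset Gset' k r t Y.
Proof. by apply/subsetP=> A; rewrite !inE => /andP[-> /eqP->] /=. Qed.

Lemma card_missing_points Y R : {in R, forall A, #|Y :\: A| <= 1} ->
  #|Y| <= #|Y :&: \bigcap_(A in R) A| + #|R|.
Proof.
move=> hR; rewrite -(cardsID (\bigcap_(A in R) A) Y) leq_add2l.
have sub : Y :\: \bigcap_(A in R) A \subset \bigcup_(A in R) (Y :\: A).
  apply/subsetP=> x; rewrite inE => /andP[xR xY].
  have : ~~ ([set x] \subset \bigcap_(A in R) A) by rewrite sub1set.
  case/not_sub_bigcap=> A AR; rewrite sub1set => xA.
  by apply/bigcupP; exists A => //; rewrite inE xA.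
apply: leq_trans (subset_leq_card sub) _; apply: leq_trans (card_bigcup_le _ _) _.
by rewrite -sum1_card; apply: leq_sum.
Qed.

Lemma Gset'_missing k r t Y A : #|Y| = r + t -> A \in Gset' k r t Y ->
  #|Y :\: A| <= 1.
Proof.
by move=> cY; rewrite !inE setIC => /andP[_ hA]; rewrite cardsD cY; lia.
Qed.

(** For [#|Y| = r + t] and [r > 0], the slices at the points of [Y] partition [Gset k r t Y]. *)
Definition slice k Y y := [set A : {set T} | (#|A| == k) && (A :&: Y == Y :\ y)].

Lemma slice_Gset k r t Y y A : #|Y| = r + t -> y \in Y -> A \in slice k Y y ->
  A \in Gset k r t Y.
Proof.
move=> cY yY; rewrite !inE => /andP[-> /eqP->] /=.
by have := cardsD1 y Y; rewrite yY cY => e; apply/eqP; lia.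
Qed.

Lemma slice_inj k Y y y' A : y \in Y -> A \in slice k Y y -> A \in slice k Y y' ->
  y = y'.
Proof.
move=> yY; rewrite !inE => /andP[_ /eqP eA] /andP[_ /eqP eA'].
have : y \notin Y :\ y' by rewrite -eA' eA !inE eqxx.
by rewrite !inE yY andbT negbK => /eqP.
Qed.

Lemma Gset_slice k r t Y A : 0 < r -> #|Y| = r + t -> A \in Gset k r t Y ->
  exists2 y, y \in Y & A \in slice k Y y.
Proof.
move=> r0 cY; rewrite !inE setIC => /andP[cA /eqP hA].
have : #|Y :\: A| == 1 by rewrite cardsD cY hA; apply/eqP; lia.
case/cards1P=> y eY; have : y \in Y :\: A by rewrite eY set11.
rewrite inE => /andP[yA yY]; exists y => //; rewrite inE cA /= -eY.
by rewrite setDDr setDv set0U setIC.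
Qed.

End Slices.

(** * Triangles in the extremal families *)

Section Triangles.
Context {n : nat}.
Implicit Types (A B S Y Z : {set 'I_n}) (F R T : {set {set 'I_n}}).

Lemma rwise_intersectingP r t F : 0 < r ->
  reflect (meeting r t F) (rwise_intersecting r t F).
Proof.
move=> r0; apply: (iffP forallP) => [hF R RF /set0Pn[A0 A0R] Rr|hF f].
  (* The default [A0] pads the enumeration of [R] to length [r] by repeating a member. *)
  pose f := [ffun i : 'I_r => nth A0 (enum R) i].
  have fR i : f i \in R.
    rewrite ffunE; have [lt|ge] := ltnP i (size (enum R)).
      by rewrite -(mem_enum R) mem_nth.
    by rewrite nth_default.
  have /implyP := hF f.
  have -> : [forall i, f i \in F] by apply/forallP=> i; apply: (subsetP RF).
  move=> /(_ isT) /leq_trans; apply; apply: subset_leq_card.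
  apply/bigcapsP=> A AR.
  have lt : index A (enum R) < r.
    by apply: leq_trans Rr; rewrite cardE index_mem mem_enum.
  apply: subset_trans (bigcap_inf (Ordinal lt) isT) _.
  by rewrite ffunE nth_index // mem_enum.
apply/implyP=> /forallP fF; pose R := [set f i | i : 'I_r].
have : t <= #|\bigcap_(A in R) A|.
  apply: hF.
  - by apply/subsetP=> _ /imsetP[i _ ->].
  - by apply/set0Pn; exists (f (Ordinal r0)); apply: imset_f.
  - by apply: leq_trans (leq_imset_card _ _) _; rewrite card_ord.
move/leq_trans; apply; apply: subset_leq_card; apply/bigcapsP=> i _.
by apply: bigcap_inf; apply: imset_f.
Qed.

Definition triangles r t F :=
  [set T : {set {set 'I_n}} | (T \subset F) && triangle r t T].

Lemma triangleE r t F T : 0 < r -> rwise_intersecting r t F -> T \subset F ->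
  triangle r t T = (#|T| == r.+1) && (#|\bigcap_(A in T) A| < t).
Proof.
move=> r0 /(rwise_intersectingP _ _ r0) hF TF; rewrite /triangle.
suff -> : rwise_intersecting r t T by [].
apply/rwise_intersectingP => // R RT; apply: hF; exact: subset_trans RT TF.
Qed.

(** At most [r] members together miss at most [r] of the [r + t] points of [Y]. *)
Lemma Gset'_intersecting k r t Y : 0 < r -> #|Y| = r + t ->
  rwise_intersecting r t (Gset' k r t Y).
Proof.
move=> r0 cY; apply/rwise_intersectingP => // R RG _ Rr.
have /card_missing_points : {in R, forall A, #|Y :\: A| <= 1}.
  by move=> A /(subsetP RG); apply: Gset'_missing.
have := subset_leq_card (subsetIr Y (\bigcap_(A in R) A)).
by rewrite cY; lia.
Qed.

(** The other [r] members of a triangle leave at least [t] points of [Y] in common, and a member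
    containing [Y] would keep them all. *)
Lemma triangle_Gset k r t Y T : #|Y| = r + t -> T \subset Gset' k r t Y ->
  triangle r t T -> T \subset Gset k r t Y.
Proof.
move=> cY TG /and3P[/eqP cT _ ntT]; apply/subsetP=> A AT.
have := subsetP TG A AT; rewrite !inE => /andP[-> hA] /=.
apply: contraTT ntT => nA; rewrite -leqNgt.
have YA : Y \subset A.
  have lt : r + t - 1 < #|A :&: Y| by rewrite ltn_neqAle eq_sym nA hA.
  have : #|Y| <= #|A :&: Y| by rewrite cY; lia.
  move=> le; have /eqP <- : A :&: Y == Y by rewrite eqEcard subsetIr.
  exact: subsetIl.
have /card_missing_points : {in T :\ A, forall B, #|Y :\: B| <= 1}.
  by move=> B; rewrite inE => /andP[_ /(subsetP TG)]; apply: Gset'_missing.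
have -> : #|T :\ A| = r by move: cT; rewrite (cardsD1 A T) AT => -[].
rewrite -{2}(setD1K AT) bigcap_setU1 cY addnC leq_add2r => /leq_trans; apply.
by apply/subset_leq_card/setSI.
Qed.

Lemma triangles_sub_Gset k r t Y F : #|Y| = r + t ->
  F \subset Gset' k r t Y -> triangles r t F \subset triangles r t (Gset k r t Y).
Proof.
move=> cY FG; apply/subsetP=> T; rewrite !inE => /andP[TF tT]; rewrite tT andbT.
by apply: triangle_Gset tT => //; apply: subset_trans FG.
Qed.

(** Each [y] in [R] is missed by [f y], so the common points lie in [Y :\: R], which has [t - 1]
    points. *)
Lemma slice_triangle k r t Y (R : {set 'I_n}) (f : 'I_n -> {set 'I_n}) : 0 < r ->
  #|Y| = r + t -> R \subset Y -> #|R| = r.+1 ->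
  {in R, forall y, f y \in slice k Y y} ->
  \bigcap_(y in R) f y \subset Y ->
  f @: R \in triangles r t (Gset k r t Y).
Proof.
move=> r0 cY RY cR fs capY; rewrite inE.
have sG : f @: R \subset Gset k r t Y.
  apply/subsetP=> _ /imsetP[y yR ->]; apply: slice_Gset (fs y yR) => //.
  exact: (subsetP RY).
rewrite sG (triangleE r0 (Gset'_intersecting k r0 cY)); last first.
  by apply: subset_trans sG _; apply: Gset_sub.
rewrite card_in_imset ?cR ?eqxx /=; last first.
  move=> y y' yR y'R eqf; apply: (slice_inj (k := k) (Y := Y) (A := f y)); rewrite ?fs //.
    exact: (subsetP RY).
  by rewrite eqf fs.
have sub : \bigcap_(A in f @: R) A \subset Y :\: R.
  apply/subsetP=> x /bigcapP hx.
  have xf y : y \in R -> x \in f y by move=> yR; apply/hx/imset_f.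
  rewrite inE; apply/andP; split; last by apply/(subsetP capY)/bigcapP.
  apply/negP=> xR; have := fs x xR; rewrite inE => /andP[_ /eqP /setP /(_ x)].
  by rewrite !inE eqxx xf //= (subsetP RY).
apply: leq_ltn_trans (subset_leq_card sub) _.
by rewrite cardsDS // cY cR; have := subset_leq_card RY; lia.
Qed.

End Triangles.

(** * Counting slices and triangles *)

Lemma card_pfamily_const (aT rT : finType) (y0 : rT) (D : {set aT})
    (E : aT -> {set rT}) c : {in D, forall x, #|E x| = c} ->
  #|[set f : {ffun aT -> rT} | f \in pfamily y0 (mem D) E]| = c ^ #|D|.
Proof.
move=> hE; rewrite cardsE card_pfamily foldrE big_image /=.
by rewrite -prod_nat_const; apply: eq_bigr => x /hE.
Qed.

Lemma exists_subset_card (T : finType) (A : {set T}) m : m <= #|A| ->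
  exists2 B : {set T}, B \subset A & #|B| = m.
Proof.
rewrite -bin_gt0 -cards_draws card_gt0 => /set0Pn[B].
by rewrite inE => /andP[BA /eqP]; exists B.
Qed.

Lemma leq_bin_exp p q : 'C(p, q) <= p ^ q.
Proof.
apply: (@leq_trans ('C(p, q) * q`!)); first by rewrite leq_pmulr ?fact_gt0.
rewrite bin_ffact; elim: q p => [|q IH] p; first by rewrite ffactn0.
by rewrite ffactnSr expnSr leq_mul // leq_subr.
Qed.

Section SliceCounts.
Context {T : finType}.
Implicit Types (A S Y : {set T}) (F : {set {set T}}).

(** This puts slices in the interval form counted by [card_between]. *)
Lemma sliceE k Y y : y \in Y -> slice k Y y =
  [set A : {set T} | [&& #|A| == k, Y :\ y \subset A & A \subset [set~ y]]].
Proof.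
move=> yY; apply/setP=> A; rewrite !inE; congr (_ && _); apply/eqP/andP.
- move=> e; rewrite -e subsetIl; split=> //; apply/subsetP=> x xA.
  rewrite !inE; apply/eqP=> xy; have : y \in A :&: Y by rewrite inE -xy xA xy.
  by rewrite e !inE eqxx.
- case=> sub1 sub2; apply/setP=> x; rewrite !inE.
  have [xA|xA] := boolP (x \in A).
    by have := subsetP sub2 _ xA; rewrite !inE => ->.
  by apply/esym/negP=> h; case/negP: xA; apply: (subsetP sub1); rewrite !inE.
Qed.

Lemma card_slice k a Y y : y \in Y -> #|Y| = a.+1 -> a <= k ->
  #|slice k Y y| = 'C(#|T| - a.+1, k - a).
Proof.
move=> yY cY ak; have cD : #|Y :\ y| = a by have := cardsD1 y Y; rewrite yY cY => -[].
rewrite sliceE // card_between ?cD // ?cardsC1; first by congr 'C(_, _); lia.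
by apply/subsetP=> x; rewrite !inE => /andP[].
Qed.

Lemma card_slice_mem k a Y y x : y \in Y -> #|Y| = a.+1 -> a < k -> x \notin Y ->
  #|[set A in slice k Y y | x \in A]| = 'C(#|T| - a.+2, k - a.+1).
Proof.
move=> yY cY ak xY; have cD : #|x |: (Y :\ y)| = a.+1.
  by rewrite cardsU1 !inE (negPf xY) andbF; have := cardsD1 y Y; rewrite yY cY => -[->].
have -> : [set A in slice k Y y | x \in A] =
    [set A : {set T} | [&& #|A| == k, x |: (Y :\ y) \subset A & A \subset [set~ y]]].
  apply/setP=> A; rewrite sliceE // !inE subUset sub1set.
  by case: (x \in A); rewrite ?andbT ?andbF.
rewrite card_between ?cD // ?cardsC1; first by congr 'C(_, _); lia.
apply/subsetP=> z; rewrite !inE => /orP[/eqP->|/andP[]//].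
by apply: contraNneq xY => ->.
Qed.

Lemma card_family_above k F S : {in F, forall A, #|A| = k} -> #|S| <= k ->
  #|family_above F S| <= 'C(#|T| - #|S|, k - #|S|).
Proof.
move=> hk Sk; rewrite -cardsT -(card_between (subsetT S) Sk).
apply/subset_leq_card/subsetP=> A; rewrite !inE => /andP[AF ->].
by rewrite hk // eqxx subsetT.
Qed.

(** Such an [R] is recovered from one member in [L] and its [r] remaining members. *)
Lemma card_subfamilies_meeting F (L : {set {set T}}) r (P : {set {set {set T}}}) :
  (forall R : {set {set T}}, R \in P ->
     [/\ R \subset F, #|R| = r.+1 & exists2 A, A \in L & A \in R]) ->
  #|P| <= #|L| * #|F| ^ r.
Proof.
move=> hP; pose D := [set R : {set {set T}} | (R \subset F) && (#|R| == r)].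
have sub : P \subset [set p.1 |: p.2 | p in setX L D].
  apply/subsetP=> R /hP[RF cR [A AL AR]]; apply/imsetP; exists (A, R :\ A).
    rewrite !inE AL /= (subset_trans (subsetDl _ _) RF) /=.
    by have := cardsD1 A R; rewrite AR cR => -[->].
  by rewrite /= setD1K.
apply: leq_trans (subset_leq_card sub) _; apply: leq_trans (leq_imset_card _ _) _.
rewrite cardsX leq_mul2l; apply/orP; right; rewrite cards_draws; exact: leq_bin_exp.
Qed.

End SliceCounts.

Definition slice_triangles n k r t (Y : {set 'I_n}) y :=
  [set T in triangles r t (Gset k r t Y) | [exists A in T, A \in slice k Y y]].

(* A choice of one set in each of [r.+1] slices gives a triangle unless all the
   chosen sets share a point [x] outside [Y]. *)
Lemma card_slice_triangles n k r t (Y : {set 'I_n}) y0 : 0 < r -> 0 < t ->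
  #|Y| = r + t -> r + t <= k -> y0 \in Y ->
  'C(n - (r + t), (k - (r + t)).+1) ^ r.+1 <=
  #|slice_triangles k r t Y y0| +
  (n - (r + t)) * 'C((n - (r + t)).-1, k - (r + t)) ^ r.+1.
Proof.
move=> r0 t0 cY rtk y0Y.
have [a ea] : exists a, r + t = a.+1 by exists (r + t).-1; lia.
have [R0 R0Y cR0] : exists2 R : {set 'I_n}, R \subset Y :\ y0 & #|R| = r.
  apply: exists_subset_card; have := cardsD1 y0 Y; rewrite y0Y cY => e; lia.
pose R := y0 |: R0.
have cR : #|R| = r.+1.
  rewrite cardsU1 cR0; suff -> : y0 \notin R0 by [].
  by apply/negP=> /(subsetP R0Y); rewrite !inE eqxx.
have RY : R \subset Y.
  by rewrite subUset sub1set y0Y (subset_trans R0Y) // subsetDl.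
pose P := [set f : {ffun 'I_n -> {set 'I_n}} | f \in pfamily set0 (mem R) (slice k Y)].
pose good := [set f in P | \bigcap_(y in R) f y \subset Y].
pose bad x := [set f : {ffun 'I_n -> {set 'I_n}} |
  f \in pfamily set0 (mem R) (fun y => [set A in slice k Y y | x \in A])].
have cP : #|P| = 'C(n - (r + t), (k - (r + t)).+1) ^ r.+1.
  rewrite -cR; apply: card_pfamily_const => y /(subsetP RY) yY.
  rewrite (card_slice yY (etrans cY ea)); last by lia.
  by rewrite card_ord; congr 'C(_, _); lia.
have cbad x : x \in ~: Y -> #|bad x| = 'C((n - (r + t)).-1, k - (r + t)) ^ r.+1.
  rewrite inE => xY; rewrite -cR; apply: card_pfamily_const => y /(subsetP RY) yY.
  rewrite (card_slice_mem yY (etrans cY ea) _ xY); last by lia.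
  by rewrite card_ord; congr 'C(_, _); lia.
have sub : P \subset good :|: \bigcup_(x in ~: Y) bad x.
  apply/subsetP=> f fP; rewrite inE.
  have [capY|] := boolP (\bigcap_(y in R) f y \subset Y).
    by apply/orP; left; rewrite inE fP.
  case/subsetPn=> x /bigcapP xf xY; apply/orP; right; apply/bigcupP; exists x.
    by rewrite inE.
  move: fP; rewrite !inE => /pfamilyP[fs fR]; apply/pfamilyP; split=> // y yR.
  by rewrite inE fR // xf.
(* A set determines its slice, so the image of [f] recovers [f] on [R]; off [R] the value is
   [set0]. *)
have inj : {in good &, injective (fun f : {ffun 'I_n -> {set 'I_n}} => f @: R)}.
  move=> f g; rewrite inE => /andP[]; rewrite inE => /pfamilyP[fs fR] _.
  rewrite inE => /andP[]; rewrite inE => /pfamilyP[gs gR] _ eqfg.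
  apply/ffunP=> y; have [yR|yR] := boolP (y \in R).
    have : f y \in g @: R by rewrite -eqfg imset_f.
    case/imsetP=> y' y'R e; suff yy' : y = y' by rewrite e yy'.
    apply: (slice_inj (k := k) (Y := Y) (A := f y)); rewrite ?fR //.
      exact: (subsetP RY).
    by rewrite e gR.
  by rewrite (supportP fs) // (supportP gs).
rewrite -cP; apply: leq_trans (subset_leq_card sub) _.
apply: leq_trans (leq_card_setU _ _) _; apply: leq_add.
  rewrite -(card_in_imset inj); apply/subset_leq_card/subsetP=> _ /imsetP[f fg ->].
  move: fg; rewrite inE => /andP[]; rewrite inE => /pfamilyP[_ fR] capY.
  rewrite inE (slice_triangle r0 cY RY cR fR capY) /=; apply/exists_inP.
  by exists (f y0); [apply: imset_f|apply: fR]; rewrite setU11.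
apply: leq_trans (card_bigcup_le _ _) _; rewrite (eq_bigr _ cbad) sum_nat_const.
by rewrite cardsCs setCK card_ord cY.
Qed.

(** * Invariance under permutations of the ground set *)

Section Permutations.
Context {n : nat} (s : {perm 'I_n}).
Implicit Types (A Y : {set 'I_n}) (F R T : {set {set 'I_n}}).

Definition perm_family F := [set s @: A | A : {set 'I_n} in F].

Lemma bigcap_perm_family R :
  \bigcap_(A in perm_family R) A = s @: \bigcap_(A in R) A.
Proof.
apply/setP=> x; rewrite -(permKV s x) mem_imset; last exact: perm_inj.
apply/bigcapP/bigcapP=> [H A AR|H _ /imsetP[A AR ->]].
  by rewrite -(mem_imset _ _ (@perm_inj _ s)); apply/H/imset_f.
by rewrite mem_imset; [apply: H|apply: perm_inj].
Qed.

Lemma perm_family_inj : injective perm_family.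
Proof. by apply/imset_inj/imset_inj/perm_inj. Qed.

Lemma card_perm_family F : #|perm_family F| = #|F|.
Proof. by rewrite card_imset //; apply/imset_inj/perm_inj. Qed.

Lemma perm_familyS F F' : F \subset F' -> perm_family F \subset perm_family F'.
Proof. exact: imsetS. Qed.

End Permutations.

Lemma perm_familyK n (s : {perm 'I_n}) :
  cancel (perm_family s) (perm_family s^-1%g).
Proof.
have K (A : {set 'I_n}) : s^-1%g @: (s @: A) = A.
  rewrite -imset_comp -[RHS]imset_id; apply: eq_imset => x; exact: permK.
move=> F; rewrite /perm_family -imset_comp -[RHS]imset_id.
by apply: eq_imset => A; apply: K.
Qed.

Lemma perm_familyKV n (s : {perm 'I_n}) :
  cancel (perm_family s^-1%g) (perm_family s).
Proof. by move=> F; have := perm_familyK s^-1%g F; rewrite invgK. Qed.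

Lemma perm_family_triangle n (s : {perm 'I_n}) r t T : 0 < r ->
  triangle r t T -> triangle r t (perm_family s T).
Proof.
move=> r0 /and3P[cT /(rwise_intersectingP _ _ r0) hT capT]; apply/and3P; split.
- by rewrite card_perm_family.
- apply/rwise_intersectingP => // R RT R0 Rr.
  rewrite -(perm_familyKV s R) bigcap_perm_family card_imset; last exact: perm_inj.
  apply: hT.
  + by rewrite -(perm_familyK s T) perm_familyS.
  + by rewrite -card_gt0 card_perm_family card_gt0.
  + by rewrite card_perm_family.
- by rewrite bigcap_perm_family card_imset //; apply: perm_inj.
Qed.

Lemma num_triangles_perm n (s : {perm 'I_n}) r t F : 0 < r ->
  num_triangles r t (perm_family s F) = num_triangles r t F.
Proof.
move=> r0.
have le (s' : {perm 'I_n}) F' :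
    num_triangles r t F' <= num_triangles r t (perm_family s' F').
  rewrite /num_triangles -(card_imset _ (@perm_family_inj n s')).
  apply/subset_leq_card/subsetP=> _ /imsetP[T + ->]; rewrite !inE => /andP[TF tT].
  by rewrite perm_familyS // perm_family_triangle.
apply/eqP; rewrite eqn_leq le andbT.
by apply: leq_trans (le s^-1%g _) _; rewrite perm_familyK.
Qed.

(** List each set followed by its complement and match equal positions. *)
Lemma exists_perm_imset (T : finType) (Y Y' : {set T}) : #|Y| = #|Y'| ->
  exists s : {perm T}, s @: Y = Y'.
Proof.
move=> cY; pose l (Z : {set T}) := enum Z ++ enum (~: Z).
have szl Z : size (l Z) = #|T| by rewrite size_cat -!cardE cardsC.
have meml Z x : x \in l Z by rewrite mem_cat !mem_enum !inE orbN.
have uql Z : uniq (l Z).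
  rewrite cat_uniq !enum_uniq andbT /=; apply/hasPn=> x.
  by rewrite !mem_enum inE.
pose f x := nth x (l Y') (index x (l Y)).
have lt x : index x (l Y) < size (l Y') by rewrite szl -(szl Y) index_mem.
have injf : injective f.
  move=> x y; rewrite /f (set_nth_default y) // => /eqP.
  rewrite nth_uniq // => /eqP e.
  by rewrite -(nth_index y (meml Y x)) e nth_index.
exists (perm injf); apply/eqP; rewrite eqEcard card_imset; last exact: perm_inj.
rewrite cY leqnn andbT; apply/subsetP=> _ /imsetP[x xY ->].
rewrite permE /f index_cat mem_enum xY nth_cat -cardE -cY cardE.
by rewrite index_mem mem_enum xY -mem_enum mem_nth // -cardE -cY cardE index_mem mem_enum.
Qed.

Lemma card_initseg n m : m <= n -> #|initseg n m| = m.
Proof.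
move=> mn; have -> : initseg n m = [set widen_ord mn i | i : 'I_m].
  apply/setP=> x; rewrite inE; apply/idP/imsetP=> [xm|[i _ ->]]; last exact: ltn_ord i.
  by exists (Ordinal xm) => //; apply/val_inj.
rewrite card_imset ?card_ord // => i j e; apply/val_inj; exact: (congr1 val e).
Qed.

Lemma perm_family_eq n (s : {perm 'I_n}) (F F' : {set {set 'I_n}}) :
  (forall A : {set 'I_n}, (s @: A \in F') = (A \in F)) -> perm_family s F = F'.
Proof.
move=> H; apply/setP=> B.
have -> : B = s @: (s^-1%g @: B).
  rewrite -imset_comp -[LHS]imset_id; apply: eq_imset => x; exact/esym/permKV.
by rewrite H mem_imset //; apply/imset_inj/perm_inj.
Qed.

Lemma perm_family_Gset n k r t (s : {perm 'I_n}) (Y : {set 'I_n}) :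
  perm_family s (Gset k r t Y) = Gset k r t (s @: Y).
Proof.
apply: perm_family_eq => A; have inj := @perm_inj _ s.
by rewrite !inE -imsetI ?card_imset // => x y _ _; apply: inj.
Qed.

Lemma perm_family_Gset' n k r t (s : {perm 'I_n}) (Y : {set 'I_n}) :
  perm_family s (Gset' k r t Y) = Gset' k r t (s @: Y).
Proof.
apply: perm_family_eq => A; have inj := @perm_inj _ s.
by rewrite !inE -imsetI ?card_imset // => x y _ _; apply: inj.
Qed.

Lemma GfamE n k r t : Gfam n k r t = Gset k r t (initseg n (r + t)).
Proof. by apply/setP=> A; rewrite !inE. Qed.

Lemma Gfam'E n k r t : Gfam' n k r t = Gset' k r t (initseg n (r + t)).
Proof. by apply/setP=> A; rewrite !inE. Qed.

Lemma num_triangles_Gset_Gfam n k r t (Y : {set 'I_n}) : 0 < r -> #|Y| = r + t ->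
  num_triangles r t (Gset k r t Y) = num_triangles r t (Gfam n k r t).
Proof.
move=> r0 cY; have rtn : r + t <= n by rewrite -cY -[n in _ <= n]card_ord max_card.
have [|s es] := @exists_perm_imset _ Y (initseg n (r + t)).
  by rewrite cY card_initseg.
by rewrite -(num_triangles_perm s) // perm_family_Gset es GfamE.
Qed.

(** * Comparison of the counts, and the final dichotomy *)

(** Write [N = n - (r + t)], [p = k - (r + t)], [L = 'C(N, p)] and [M = 'C(N, p.+1)]. The two
    summands are at most [Q * L * M ^ r] and [k * L * M ^ r], while [M] exceeds [(Q + k) * L] for
    large [n]. *)
Lemma light_lt_slices r t k n : 0 < r -> 0 < t -> r + t <= k ->
  (2 ^ r + 2) * k ^ ((r + t - 1) * r.+1 + 2) <= n ->
  k ^ (r + t - 1) * (k * 'C(n - (r + t), k - (r + t)))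
    * (k ^ (r + t - 1) * 'C(n - (r + t - 1), k - (r + t - 1))) ^ r
  + (n - (r + t)) * 'C((n - (r + t)).-1, k - (r + t)) ^ r.+1
  < 'C(n - (r + t), (k - (r + t)).+1) ^ r.+1.
Proof.
move=> r0 t0 rtk hn.
set a := r + t - 1 in hn *; set E := a * r.+1 in hn.
have k0 : 0 < k by lia.
have kE : k <= k ^ (E + 2) by rewrite -{1}(expn1 k) leq_pexp2l //; lia.
have kkE : k * k <= k ^ (E + 2) by rewrite -[k * k]/(k ^ 2) leq_pexp2l //; lia.
have kP : 2 ^ r * k ^ E.+1 * k = 2 ^ r * k ^ (E + 2).
  by rewrite -mulnA -expnSr addn2.
(* The summand [2 ^ r] of the constant pays for the first term here, and the summand [2] for [k * k]
   and [k]. *)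
have hn2 : 2 ^ r * k ^ E.+1 * k + k * k + k <= n.
  by rewrite kP; apply: leq_trans hn; rewrite mulnDl -addnA leq_add2l; lia.
have [Q eQ] : exists Q, Q = 2 ^ r * k ^ E.+1 by eexists.
rewrite -eQ in hn2.
have rtn : r + t < n by nia.
rewrite (_ : n - a = (n - (r + t)).+1); last by rewrite /a; lia.
rewrite (_ : k - a = (k - (r + t)).+1); last by rewrite /a; lia.
have hNp : (k - (r + t)).+1 * (Q + k) < n - (r + t) - (k - (r + t)) by nia.
have pk : (k - (r + t)).+1 <= k by lia.
move: (n - (r + t)) (k - (r + t)) hNp pk => N p hNp pk.
rewrite binS; have := mul_bin_left N p; have := mul_bin_diag N p.
have : 'C(N.-1, p) <= 'C(N, p) by apply: leq_bin2l; lia.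
have : 0 < 'C(N, p) by rewrite bin_gt0; lia.
move: 'C(N, p) 'C(N, p.+1) 'C(N.-1, p) => L M L' L0 L'L eL' eM.
have QM : (Q + k) * L < M.
  rewrite -(ltn_pmul2l (ltn0Sn p)) eM mulnA ltn_pmul2r //.
have LM : L <= M by apply: leq_trans (ltnW QM); rewrite leq_pmull //; lia.
(* By Pascal's rule [M + L] is the binomial that bounds the size of [F]; this is the source of
   [2 ^ r]. *)
have M2 : (M + L) ^ r <= 2 ^ r * M ^ r by rewrite -expnMn leq_exp2r //; lia.
have h1 : k ^ a * (k * L) * (k ^ a * (M + L)) ^ r <= Q * L * M ^ r.
  rewrite expnMn -expnM eQ.
  apply: (@leq_trans (k ^ a * (k * L) * (k ^ (a * r) * (2 ^ r * M ^ r)))).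
    by rewrite !leq_mul2l M2 !orbT.
  rewrite (_ : k ^ E.+1 = k ^ a * k * k ^ (a * r)); first by nia.
  by rewrite -expnSr -expnD; congr (_ ^ _); rewrite /E; lia.
(* The factor [N] is absorbed by [N * L' = p.+1 * M] with [p.+1 <= k]. *)
have h2 : N * L' ^ r.+1 <= k * L * M ^ r.
  rewrite expnS mulnA eL'; case: r r0 {E a eQ M2 h1 hn kE kkE kP rtk rtn} => // r _.
  have : L' ^ r.+1 <= L * M ^ r.
    rewrite expnS leq_mul //; case: r => // r; rewrite leq_exp2r //; lia.
  rewrite (expnS M) => h; apply: (@leq_trans (p.+1 * M * (L * M ^ r))).
    by rewrite leq_mul2l h orbT.
  apply: (@leq_trans (k * M * (L * M ^ r))); last by nia.
  by rewrite !leq_mul2r pk !orbT.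
apply: leq_ltn_trans (leq_add h1 h2) _; rewrite expnS.
rewrite -mulnDl -mulnDl ltn_pmul2r // expn_gt0; lia.
Qed.

Lemma leq_slice_triangles n k r t (Y : {set 'I_n}) y :
  #|slice_triangles k r t Y y| <= num_triangles r t (Gset k r t Y).
Proof. by apply/subset_leq_card/subsetP=> T /setIdP[]. Qed.

(** In the second alternative, inclusion of the sets of triangles alone gives the desired
    inequality. *)
Lemma few_triangles_or_sub_Gset' n k r t (F : {set {set 'I_n}}) :
  1 < r -> 0 < t -> r + t <= k ->
  (2 ^ r + 2) * k ^ ((r + t - 1) * r.+1 + 2) <= n ->
  F \subset ksubsets n k -> rwise_intersecting r t F ->
  num_triangles r t F < num_triangles r t (Gfam n k r t) \/
  exists2 Y : {set 'I_n}, #|Y| = r + t & F \subset Gset' k r t Y.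
Proof.
move=> r1 t0 rtk hn Fk rF; have r0 : 0 < r by lia.
have hF := rwise_intersectingP _ _ r0 rF.
have hk : {in F, forall A : {set 'I_n}, #|A| = k}.
  by move=> A /(subsetP Fk); rewrite inE => /eqP.
have kn : k <= n.
  apply: leq_trans hn; apply: (@leq_trans (k ^ ((r + t - 1) * r.+1 + 2))).
    by rewrite -{1}(expn1 k) leq_pexp2l //; lia.
  by apply: leq_pmull; lia.
have rtn : r + t <= n by lia.
pose a := r + t - 1; pose H := heavy a k F; pose W := light a k F.
pose lightT := [set T in triangles r t F | [exists A in T, A \in W]].
have triF (T : {set {set 'I_n}}) : T \in triangles r t F ->
    [/\ T \subset F, #|T| = r.+1 & #|\bigcap_(A in T) A| < t].
  rewrite inE => /andP[TF]; rewrite (triangleE r0 rF TF) => /andP[/eqP].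
  by move=> ? ?; split.
(* The bound for [#|W|] times the [r]-th power of the bound for [#|F|]. *)
pose lightB := k ^ a * (k * 'C(n - (r + t), k - (r + t)))
  * (k ^ a * 'C(n - a, k - a)) ^ r.
have lt_slice (Y : {set 'I_n}) y : #|Y| = r + t -> y \in Y ->
    lightB < #|slice_triangles k r t Y y|.
  move=> cY yY; have := card_slice_triangles r0 t0 cY rtk yY.
  move/(leq_trans (light_lt_slices r0 t0 rtk hn)).
  by rewrite ltn_add2r.
have ltG (Y : {set 'I_n}) y b : #|Y| = r + t -> y \in Y -> b <= lightB ->
    b < num_triangles r t (Gfam n k r t).
  move=> cY yY bB; rewrite -(num_triangles_Gset_Gfam k r0 cY).
  apply: leq_ltn_trans bB _; apply: leq_trans (lt_slice Y y cY yY) _.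
  exact: leq_slice_triangles.
(* An arbitrary [Y0] suffices where [F] is compared with the extremal family before [Y] is found. *)
have [Y0 cY0 [y0 y0Y0]] : exists2 Y : {set 'I_n}, #|Y| = r + t & exists y, y \in Y.
  have cI := card_initseg rtn; exists (initseg n (r + t)) => //.
  by apply/set0Pn; rewrite -card_gt0 cI; lia.
have [trivF|ntF] := leqP t #|\bigcap_(A in F) A|.
  left; suff -> : num_triangles r t F = 0 by apply: (ltG Y0 y0).
  apply/eqP; rewrite cards_eq0; apply/eqP/setP=> T; rewrite [RHS]inE.
  apply/negP=> /triF[TF _].
  by have := subset_leq_card (sub_bigcap TF); lia.
have cW : #|W| <= k ^ a * (k * 'C(n - (r + t), k - (r + t))).
  apply: (card_light r1 hF ntF hk) => S cS.
  by have := @card_family_above _ k F S hk; rewrite cS card_ord; apply.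
have cF : #|F| <= k ^ a * 'C(n - a, k - a).
  apply: (card_subfamily_le r1 hF ntF hk (subxx F)) => S cS.
  have := @card_family_above _ k F S hk; rewrite cS card_ord -/a; apply.
  by rewrite /a; lia.
have cL : #|lightT| <= lightB.
  apply: (@leq_trans (#|W| * #|F| ^ r)).
    apply: card_subfamilies_meeting => T; rewrite inE => /andP[/triF[TF cT _]].
    by case/exists_inP=> A AT AW; split=> //; exists A.
  by apply: leq_mul => //; rewrite leq_exp2r.
have heavyT (T : {set {set 'I_n}}) : T \in triangles r t F -> T \notin lightT ->
    {in T, forall A : {set 'I_n}, exists2 S : {set 'I_n}, S \in H & S \subset A}.
  move=> tT; rewrite inE tT /= => /exists_inPn nT A AT.
  have [TF _ _] := triF T tT; have := nT A AT.
  rewrite inE (subsetP TF) //= => /forall_inPn[S SH]; rewrite negbK.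
  by exists S.
have cH : {in H, forall S : {set 'I_n}, #|S| = a} by move=> S; rewrite inE => /andP[/eqP].
have ak : a <= k by rewrite /a; lia.
(* If the heavy sets share [t] points, so do the members of any triangle without light members,
   which is impossible. *)
have [trivH|ntH] := leqP t #|\bigcap_(S in H) S|.
  left; apply: (ltG Y0 y0) => //; apply: leq_trans cL.
  apply/subset_leq_card/subsetP=> T tT; apply: contraT => nlT.
  have [_ _] := triF T tT; rewrite ltnNge => /negP[].
  apply: leq_trans trivH _; apply/subset_leq_card/bigcapsP=> A AT.
  have [S SH SA] := heavyT T tT nlT A AT.
  by apply: subset_trans SA; apply: bigcap_inf.
have hFH : meeting r t (F :|: H) by apply: meeting_heavy => //; rewrite /a; lia.
have ntFH : #|\bigcap_(A in F :|: H) A| < t.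
  apply: leq_ltn_trans ntF; apply/subset_leq_card/sub_bigcap; exact: subsetUl.
have [Y cY' HY] : exists2 Y : {set 'I_n}, #|Y| = a + 1 &
    {in H, forall S : {set 'I_n}, S \subset Y}.
  apply: almost_equal_sets => //.
  - by rewrite card_ord /a; lia.
  - move=> S1 S2 H1 H2.
    have := meeting_pair (A := S1) (B := S2) r1 hFH ntFH; rewrite !inE.
    by move: (H1) (H2); rewrite !inE => -> ->; rewrite !orbT /a => /(_ isT isT); lia.
  - by apply: (@leq_trans (t + 1)); [rewrite ltn_add2r|rewrite /a; lia].
have cY : #|Y| = r + t by rewrite cY' /a; lia.
have cD y : y \in Y -> #|Y :\ y| = a.
  by move=> yY; have := cardsD1 y Y; rewrite yY cY /a => ->; rewrite addKn.
have [/forall_inP allH|/forall_inPn[y yY nH]] := boolP [forall y in Y, Y :\ y \in H].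
  right; exists Y => //; apply/subsetP=> A AF; rewrite !inE hk // eqxx /=.
  suff : r + t - 1 <= #|A :&: Y| by [].
  have [y yY] : exists y, y \in Y by apply/set0Pn; rewrite -card_gt0 cY; lia.
  (* This first bound leaves room for [r - 1] points [Q] in [A :&: Y]. Intersecting [A] with the
     heavy sets [Y :\ q] removes all of [Q] and must leave [t] points. *)
  have pA : r + t <= #|A :&: Y| + 2.
    apply: leq_trans (meeting_pair (A := A) (B := Y :\ y) r1 hFH ntFH _ _) _.
    - by rewrite inE AF.
    - by rewrite inE allH // orbT.
    - by rewrite leq_add2r; apply/subset_leq_card/setIS/subsetDl.
  have [Q QA cQ] : exists2 Q : {set 'I_n}, Q \subset A :&: Y & #|Q| = r.-1.
    by apply: exists_subset_card; lia.
  pose R := A |: [set Y :\ q | q in Q].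
  have tR : t <= #|\bigcap_(B in R) B|.
    apply: hFH.
    - rewrite subUset sub1set inE AF; apply/subsetP=> _ /imsetP[q qQ ->].
      rewrite inE allH ?orbT //.
      by have := subsetP QA q qQ; rewrite inE => /andP[].
    - by apply/set0Pn; exists A; rewrite setU11.
    - rewrite cardsU1; apply: (@leq_trans (1 + r.-1)); last by lia.
      by apply: leq_add; [case: (_ \notin _)|rewrite -cQ leq_imset_card].
  have sub : \bigcap_(B in R) B \subset (A :&: Y) :\: Q.
    have [q0 q0Q] : exists q, q \in Q by apply/set0Pn; rewrite -card_gt0 cQ; lia.
    apply/subsetP=> x /bigcapP hx.
    have xA : x \in A by apply: hx; rewrite setU11.
    have xD q : q \in Q -> x \in Y :\ q.
      by move=> qQ; apply: hx; rewrite setU1r //; apply: imset_f.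
    have /setD1P[_ xY] := xD q0 q0Q; rewrite !inE xA xY !andbT.
    by apply/negP=> /xD; rewrite !inE eqxx.
  have := leq_trans tR (subset_leq_card sub); rewrite cardsDS // cQ => h.
  by clear -h t0 r0; lia.
left; rewrite -(num_triangles_Gset_Gfam k r0 cY).
have sub : triangles r t F \subset
    lightT :|: (triangles r t (Gset k r t Y) :\: slice_triangles k r t Y y).
  apply/subsetP=> T tT; rewrite in_setU; have [//|nlT] := boolP (T \in lightT).
  have hT := heavyT T tT nlT; have [TF _ _] := triF T tT.
  have TG : T \subset Gset' k r t Y.
    apply/subsetP=> A AT; rewrite inE (hk _ (subsetP TF A AT)) eqxx /=.
    have [S SH SA] := hT A AT; rewrite -/a -(cH S SH).
    by apply: subset_leq_card; rewrite subsetI SA HY.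
  rewrite in_setD; apply/andP; split; last first.
    move: tT; rewrite !inE => /andP[_ tT]; rewrite tT andbT.
    exact: triangle_Gset tT.
  rewrite inE; apply/nandP; right; apply/exists_inP=> -[A AT].
  (* A heavy subset of [A] lies in [A :&: Y = Y :\ y], hence equals it, but [Y :\ y] is not
     heavy. *)
  rewrite inE => /andP[_ /eqP eA]; have [S SH SA] := hT A AT.
  case/negP: nH; suff <- : S = Y :\ y by [].
  by apply/eqP; rewrite eqEcard cD // (cH S SH) leqnn andbT -eA subsetI SA HY.
apply: leq_ltn_trans (subset_leq_card sub) _.
apply: leq_ltn_trans (leq_card_setU _ _) _; rewrite cardsD.
have -> : triangles r t (Gset k r t Y) :&: slice_triangles k r t Y y
    = slice_triangles k r t Y y.
  by apply/setIidPr/subsetP=> T /setIdP[].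
have := leq_slice_triangles k r t Y y; have := lt_slice Y y cY yY.
rewrite -/(triangles r t (Gset k r t Y)) /num_triangles -/(triangles _ _ _); lia.
Qed.

(** Every [A] in the extremal family lies in one of its triangles: complete it by the sets
    [(Y :\ z) :|: B] for [r] other points [z], with one [B] disjoint from [A] and [Y]. *)
Lemma Gset_sub_eq_triangles n k r t (Y : {set 'I_n}) F : 0 < r -> 0 < t ->
  #|Y| = r + t -> r + t <= k -> k + k <= n ->
  triangles r t F = triangles r t (Gset k r t Y) -> Gset k r t Y \subset F.
Proof.
move=> r0 t0 cY rtk kn eT; apply/subsetP=> A AG.
have [y yY Ay] := Gset_slice r0 cY AG.
have cA : #|A| = k by move: Ay; rewrite inE => /andP[/eqP].
have cD z : z \in Y -> #|Y :\ z| = r + t - 1.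
  by move=> zY; have := cardsD1 z Y; rewrite zY cY => ->; rewrite addKn.
have [R0 R0Y cR0] : exists2 R : {set 'I_n}, R \subset Y :\ y & #|R| = r.
  by apply: exists_subset_card; rewrite cD //; lia.
have yR0 : y \notin R0 by apply/negP=> /(subsetP R0Y); rewrite !inE eqxx.
(* The hypothesis [k + k <= n] leaves room for [B]. *)
have [B BAY cB] : exists2 B : {set 'I_n}, B \subset ~: (A :|: Y) & #|B| = k - (r + t - 1).
  apply: exists_subset_card; rewrite cardsCs setCK card_ord cardsU cA cY.
  have -> : #|A :&: Y| = r + t - 1 by move: Ay; rewrite inE => /andP[_ /eqP->]; exact: cD.
  by lia.
have BY x : x \in B -> (x \notin A) && (x \notin Y).
  by move/(subsetP BAY); rewrite !inE negb_or.
pose f z := if z == y then A else (Y :\ z) :|: B.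
have fR : {in y |: R0, forall z, f z \in slice k Y z}.
  move=> z; rewrite /f !inE; have [-> _|zy /= zR] := eqVneq z y.
    by move: Ay; rewrite inE.
  have zY : z \in Y by have := subsetP R0Y z zR; rewrite inE => /andP[].
  have BYz : B :&: Y = set0.
    by apply/setP=> x; rewrite !inE; apply/negP=> /andP[/BY/andP[_ /negP]].
  have BDz : (Y :\ z) :&: B = set0.
    apply/setP=> x; rewrite !inE; apply/negP=> /andP[/andP[_ xY]] /BY.
    by rewrite xY andbF.
  rewrite cardsU BDz cards0 cB cD // subn0 setIUl BYz setU0.
  by rewrite (setIidPl (subsetDl _ _)) eqxx andbT; apply/eqP; lia.
have RY : y |: R0 \subset Y.
  by rewrite subUset sub1set yY (subset_trans R0Y) ?subsetDl.
have cR : #|y |: R0| = r.+1 by rewrite cardsU1 yR0 cR0.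
have [z zR] : exists z, z \in R0 by apply/set0Pn; rewrite -card_gt0 cR0.
have zy : z != y by apply: contraNneq yR0 => <-.
have capY : \bigcap_(x in y |: R0) f x \subset Y.
  apply/subsetP=> x /bigcapP hx.
  have : x \in f y by apply: hx; rewrite setU11.
  have : x \in f z by apply: hx; rewrite setU1r.
  rewrite /f eqxx (negPf zy) !inE; case/orP=> [/andP[]//|/BY/andP[/negP]//].
have := slice_triangle r0 cY RY cR fR capY; rewrite -eT inE => /andP[/subsetP sF _].
by apply: sF; apply/imsetP; exists y; rewrite ?setU11 // /f eqxx.
Qed.

Lemma num_triangles_between n k r t (Y : {set 'I_n}) (F : {set {set 'I_n}}) :
  #|Y| = r + t -> Gset k r t Y \subset F -> F \subset Gset' k r t Y ->
  num_triangles r t F = num_triangles r t (Gset k r t Y).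
Proof.
move=> cY GF FG; apply/eqP; rewrite eqn_leq.
rewrite (subset_leq_card (triangles_sub_Gset cY FG)) /=.
apply/subset_leq_card/subsetP=> T; rewrite !inE => /andP[TG ->].
by rewrite (subset_trans TG).
Qed.

Theorem theorem1p4 (r t : nat) (hr : 3 <= r) (ht : 1 <= t) :
  exists c d : nat, 0 < c /\ 0 < d /\
    forall k : nat, r < k -> t <= k - r ->
    forall n : nat, c * k ^ d <= n ->
    forall F : {set {set 'I_n}},
      F \subset ksubsets n k -> rwise_intersecting r t F ->
      num_triangles r t F <= num_triangles r t (Gfam n k r t) /\
      (num_triangles r t F = num_triangles r t (Gfam n k r t) <->
       exists F' : {set {set 'I_n}},
         isomorphic F F' /\ Gfam n k r t \subset F' /\ F' \subset Gfam' n k r t).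
Proof.
(* These constants are the ones required by [light_lt_slices]. *)
exists (2 ^ r + 2), ((r + t - 1) * r.+1 + 2); split; first by rewrite addn2.
split=> [|k rk tk n hn F Fk rF]; first by rewrite addn2.
have [r0 r1 rtk] : [/\ 0 < r, 1 < r & r + t <= k] by split; lia.
have kn : k + k <= n.
  apply: leq_trans hn; apply: (@leq_trans (2 * k ^ ((r + t - 1) * r.+1 + 2))).
    rewrite addnn -mul2n leq_mul2l; apply/orP; right.
    by rewrite -{1}(expn1 k) leq_pexp2l // ?addn2 //; lia.
  by rewrite leq_mul2r leq_addl orbT.
have rtn : r + t <= n by lia.
have back : (exists F' : {set {set 'I_n}},
    isomorphic F F' /\ Gfam n k r t \subset F' /\ F' \subset Gfam' n k r t) ->
    num_triangles r t F = num_triangles r t (Gfam n k r t).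
  case=> F' [[s ->] []]; rewrite GfamE Gfam'E => GF FG.
  rewrite -(num_triangles_between (card_initseg rtn) GF FG).
  by rewrite -/(perm_family s F) num_triangles_perm.
have [lt|[Y cY FG]] := few_triangles_or_sub_Gset' r1 ht rtk hn Fk rF.
  by split; [exact: ltnW | split=> // e; rewrite e ltnn in lt].
have sT := triangles_sub_Gset cY FG.
rewrite -(num_triangles_Gset_Gfam k r0 cY) in back *; split.
  exact: subset_leq_card sT.
split=> // eN.
have GF : Gset k r t Y \subset F.
  apply: Gset_sub_eq_triangles => //.
  (* Equal numbers turn the inclusion of the sets of triangles into an equality. *)
  by apply/eqP; rewrite eqEcard sT; apply/eq_leq/esym.
have [s es] := exists_perm_imset (etrans cY (esym (card_initseg rtn))).
exists (perm_family s F); split; first by exists s.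
rewrite GfamE Gfam'E -es -perm_family_Gset -perm_family_Gset'.
by split; apply: perm_familyS.
Qed.
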